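(* Let $S\neq\mathbb{N}$ be a numerical semigroup with multiplicity $m$, type $t(S)$ and embedding dimension $e(S)$, and let $P$ be its set of primitive elements. Then $$t(S)\;\le\;\sum_{p\in P\setminus\{m\}}\nu_S(p-m)\;\le\;e(S)-1+\Xi(S)\;\le\;e(S)-1+\Theta(S).$$
   Context: $\mathbb{N}=\{0,1,2,\dots\}$. A numerical semigroup is a submonoid $S\subseteq\mathbb{N}$ (under addition) with finite complement $G(S)=\mathbb{N}\setminus S$, whose elements are the gaps. Let $S\ne\mathbb{N}$. The multiplicity $m$ is the least positive element of $S$; $F$ is the largest gap. An element $x\in S\setminus\{0\}$ is primitive if it is not a sum of two elements of $S\setminus\{0\}$; $P$ is the set of primitive elements (the minimal generators) and $e(S)=|P|$. An integer $f$ is a pseudo-Frobenius number if $f\notin S$ and $f+s\in S$ for all $s\in S\setminus\{0\}$; $\mathrm{PF}(S)$ is the set of these and $t(S)=|\mathrm{PF}(S)|$. The Apéry set is $\mathrm{Ap}(S,m)=\{u\in S: u-m\notin S\}$. For an integer $x\in[1,F]$, $\nu_S(x)=|\{f\in\mathrm{PF}(S): f-x\in S\}|$. Define $$\Theta(S)=\sum_{x\in G(S)}(\nu_S(x)-1),\qquad \Xi(S)=\sum_{w\in\mathrm{Ap}(S,m)\setminus\{0\}}\left\lfloor \frac{w}{m}\right\rfloor\bigl(\nu_S(w-m)-1\bigr).$$ *)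

(* Defs.v *)
From HB Require Import structures.
From mathcomp Require Import all_boot all_order all_algebra.
From mathcomp Require Import finmap.
From mathcomp Require Import all_classical.

Set Implicit Arguments.
Unset Strict Implicit.
Unset Printing Implicit Defensive.

Import Order.TTheory GRing.Theory Num.Theory.

Local Open Scope classical_set_scope.
Local Open Scope ring_scope.

Definition numerical_semigroup (S : set nat) : Prop :=
  [/\ S 0%N, (forall a b : nat, S a -> S b -> S (a + b)%N) & finite_set (~` S)].

Definition gaps (S : set nat) : set nat := ~` S.

(* S seen inside the integers, so that differences below are genuine integer
   differences rather than truncated ones. *)
Definition intset (S : set nat) : set int := Posz @` S.

(* The default value 0 is only taken when S has no positive element. *)
Definition multiplicity (S : set nat) : nat :=
  xget 0%N [set m : nat | [/\ S m, (0 < m)%N &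
                            forall n : nat, S n -> (0 < n)%N -> (m <= n)%N]].

Definition primitives (S : set nat) : set nat :=
  [set x | (S `\ 0%N) x /\
           ~ (exists a b : nat,
                 [/\ (S `\ 0%N) a, (S `\ 0%N) b & x = (a + b)%N])].

Definition embdim (S : set nat) : nat := #|` fset_set (primitives S)|%fset.

Definition PF (S : set nat) : set int :=
  [set f | ~ intset S f /\
           forall s : nat, (S `\ 0%N) s -> intset S (f + s%:Z)].

(* [fset_set] is empty on infinite sets; [PF S] and [primitives S] are finite
   for every numerical semigroup S other than the whole of nat. *)
Definition semigroup_type (S : set nat) : nat := #|` fset_set (PF S)|%fset.

Definition apery (S : set nat) (m : nat) : set nat :=
  [set u | S u /\ ~ intset S (u%:Z - m%:Z)].

(* Total in x; only its values between 1 and the largest gap are meaningful,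
   and every argument used below lies in that range. *)
Definition nu (S : set nat) (x : int) : nat :=
  #|` fset_set [set f | PF S f /\ intset S (f - x)]|%fset.

Definition Theta (S : set nat) : int :=
  \sum_(x \in gaps S) ((nu S x%:Z)%:Z - 1).

Definition Xi (S : set nat) : int :=
  let m := multiplicity S in
  \sum_(w \in apery S m `\ 0%N)
     ((w %/ m)%N%:Z * ((nu S (w%:Z - m%:Z))%:Z - 1)).

(* Main.v *)
Require Import Defs.
From mathcomp Require Import all_boot all_order all_algebra.
From mathcomp Require Import finmap.
From mathcomp Require Import all_classical.
From mathcomp Require Import zify.

Set Implicit Arguments.
Unset Strict Implicit.
Unset Printing Implicit Defensive.

Import Order.TTheory GRing.Theory Num.Theory.

Local Open Scope classical_set_scope.
Local Open Scope ring_scope.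

(** Say that x lies below y when y - x is in S. Then [nu S x] counts the pseudo-Frobenius numbers
    above x. It cannot increase as x goes up ([leq_nu]), and it is at least 1 at every gap, since
    each gap lies below a maximal one ([gap_below_PF]).

    The first inequality is a double count: f in PF gives f + m in S, and a primitive summand p of f
    + m differs from m because f is not in S, so every f is counted at some p.

    For the second, take 1 off each term, e(S) - 1 in total. The primitives other than m are nonzero
    Apéry elements w; for every such w, nu(w - m) - 1 is nonnegative and the weight floor(w/m) is at
    least 1.

    For the third, spread that weight, one unit each, over the gaps w - j m with 1 <= j <=
    floor(w/m). These are distinct for all w and j, and they lie below w - m, so nu is no smaller
    there. *)

Lemma ler_sum_uniq_sub (R : numDomainType) (I : eqType) (s s' : seq I)
    (F : I -> R) :
  uniq s -> uniq s' -> {subset s <= s'} -> {in s', forall i, 0 <= F i} ->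
  \sum_(i <- s) F i <= \sum_(i <- s') F i.
Proof.
move=> us us' sub F0.
have pe : perm_eq s [seq i <- s' | i \in s].
  apply: uniq_perm => //; first exact: filter_uniq.
  by move=> i; rewrite mem_filter; case: (boolP (i \in s)) => // /sub ->.
rewrite (perm_big _ pe) big_filter [leRHS](bigID (mem s)) /= lerDl big_seq_cond.
by apply: sumr_ge0 => i /andP[/F0].
Qed.

Lemma finite_set_nat_bound (A : set nat) :
  finite_set A -> exists N, forall n, A n -> (n < N)%N.
Proof.
move=> fA; exists (\max_(i <- fset_set A) i).+1 => n An.
by rewrite ltnS; apply: (@leq_bigmax_seq _ _ xpredT id) => //; rewrite in_fset_set // inE.
Qed.

Lemma finite_set_bounded (A : set nat) N :
  (forall n, A n -> (n < N)%N) -> finite_set A.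
Proof. by move=> AN; apply: (@sub_finite_set _ _ `I_N) => // n /AN. Qed.

Lemma intset_nat (S : set nat) (n : nat) : intset S n%:Z <-> S n.
Proof. by split=> [[k Sk [<-]]|Sn] //; exists n. Qed.

Section NumericalSemigroup.
Context (S : set nat) (hS : numerical_semigroup S) (hSN : S <> [set: nat]).
Local Notation m := (multiplicity S).

Let S0 : S 0%N. Proof. by case: hS. Qed.
Let SD a b : S a -> S b -> S (a + b)%N. Proof. by case: hS => _ + _; apply. Qed.
Let fG : finite_set (gaps S). Proof. by case: hS. Qed.

Lemma intsetD (a b : int) : intset S a -> intset S b -> intset S (a + b).
Proof. by case=> i Si <- [j Sj <-]; exists (i + j)%N => //; exact: SD. Qed.

Lemma semigroup_mulr (k n : nat) : S n -> S (k * n)%N.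
Proof. by move=> Sn; elim: k => [|k IH] //; rewrite mulSn; exact: SD. Qed.

(** * Multiplicity and largest gap *)

Lemma multiplicityP :
  [/\ S m, (0 < m)%N & forall n, S n -> (0 < n)%N -> (m <= n)%N].
Proof.
apply: (@xgetPex _ 0%N [set m : nat | [/\ S m, (0 < m)%N &
   forall n : nat, S n -> (0 < n)%N -> (m <= n)%N]]).
(* Finitely many gaps leave a positive element, so [xget] never falls back on its default. *)
have [N gN] := finite_set_nat_bound fG.
have ex : exists n, (0 < n)%N && `[< S n >].
  exists N.+1; apply/asboolP; apply: contrapT => Gn; have := gN _ Gn; lia.
case: (ex_minnP ex) => k /andP[k0 /asboolP Sk] kmin; exists k; split=> // n Sn n0.
by apply: kmin; rewrite n0; apply/asboolP.
Qed.

Lemma largest_gap : exists2 F, gaps S F & forall n, (F < n)%N -> S n.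
Proof.
have [N gN] := finite_set_nat_bound fG.
have ex : exists n, `[< gaps S n >].
  apply: contrapT => nex; apply: hSN; apply/seteqP; split=> // n _.
  by apply: contrapT => Gn; apply: nex; exists n; apply/asboolP.
have ub n : `[< gaps S n >] -> (n <= N)%N by move=> /asboolP/gN/ltnW.
case: (ex_maxnP ex ub) => F /asboolP GF Fmax; exists F => // n Fn.
by apply: contrapT => Gn; have /Fmax : `[< gaps S n >] by [apply/asboolP]; lia.
Qed.

(** * Pseudo-Frobenius numbers and [nu] *)

Lemma PF_gap (f : int) : PF S f -> exists2 n, f = Posz n & gaps S n.
Proof.
case: f => [n|k] [nf pf].
  by exists n => // Sn; apply: nf; apply/intset_nat.
have [F GF Fmax] := largest_gap.
(* For negative f, F - f exceeds F and so is in S; then F = f + (F - f) would be in S. *)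
exfalso; apply: GF; apply/intset_nat.
have -> : F%:Z = Negz k + (F + k.+1)%N%:Z by lia.
by apply: pf; split; [apply: Fmax; lia | move=> /=; lia].
Qed.

Lemma finite_PF : finite_set (PF S).
Proof.
apply: (@sub_finite_set _ _ (Posz @` gaps S)); last exact: finite_image.
by move=> f /PF_gap[n -> Gn]; exists n.
Qed.

Lemma finite_nu_set (x : int) : finite_set [set f | PF S f /\ intset S (f - x)].
Proof. by apply: sub_finite_set finite_PF => f []. Qed.

(** A gap that is not pseudo-Frobenius stays a gap after adding some nonzero s in S; gaps are
    bounded by F, so this climb stops. *)
Lemma gap_below_PF (x : nat) : gaps S x -> exists2 f, PF S f & intset S (f - x%:Z).
Proof.
have [F _ Fmax] := largest_gap.
have [k] := ubnP (F - x)%N; elim: k x => // k IH x lek Gx.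
have [pfx|npfx] := pselect (PF S x%:Z).
  by exists x%:Z => //; rewrite subrr; apply/intset_nat.
have [s [[Ss s0] Gxs]] : exists s, (S `\ 0%N) s /\ gaps S (x + s)%N.
  apply: contrapT => nex; apply: npfx; split; first by move=> /intset_nat.
  move=> s Ss; apply/(intset_nat S (x + s)%N).
  by apply: contrapT => Gxs; apply: nex; exists s.
have xsF : (x + s <= F)%N by rewrite leqNgt; apply/negP => /Fmax.
have [|f pf Sf] := IH (x + s)%N _ Gxs; first by move: s0 => /=; lia.
exists f => //; have -> : f - x%:Z = (f - (x + s)%N%:Z) + s%:Z by lia.
by apply: intsetD => //; apply/intset_nat.
Qed.

Lemma nu_gap_gt0 (x : nat) : gaps S x -> (0 < nu S x%:Z)%N.
Proof.
move=> /gap_below_PF[f pf Sf]; rewrite cardfs_gt0; apply/fset0Pn; exists f.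
by rewrite in_fset_set ?inE//; exact: finite_nu_set.
Qed.

Lemma leq_nu (x y : int) : intset S (y - x) -> (nu S y <= nu S x)%N.
Proof.
move=> Sxy; apply: fsubset_leq_card; apply/fsubsetP => f.
rewrite !in_fset_set; try exact: finite_nu_set.
rewrite !inE => - [pf Sf]; split=> //.
by rewrite -(subrK y f) -addrA; exact: intsetD.
Qed.

(** The indicator form allows a sum of [nu] over primitives to be exchanged with the sum over
    [PF S]. *)
Lemma nu_sum (x : int) :
  nu S x = (\sum_(f <- fset_set (PF S)) `[< intset S (f - x)%R >])%N.
Proof.
rewrite /nu -sum1_size -big_mkcondr /=.
rewrite -[RHS]big_filter; apply: perm_big; apply: uniq_perm.
- exact: fset_uniq.
- exact/filter_uniq/fset_uniq.
move=> f; rewrite mem_filter !in_fset_set; [|exact: finite_PF|exact: finite_nu_set].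
by apply/idP/andP; rewrite !inE => -[].
Qed.

(** * Primitive elements and the Apéry set *)

Lemma primitive_summand (w : nat) : S w -> w <> 0%N ->
  exists2 p, primitives S p & exists2 s, S s & w = (p + s)%N.
Proof.
have [k] := ubnP w; elim: k w => // k IH w lek Sw w0.
have [pw|npw] := pselect (primitives S w).
  by exists w => //; exists 0%N => //; rewrite addn0.
have [a [b [[Sa a0] [Sb b0] wab]]] :
    exists a b, [/\ (S `\ 0%N) a, (S `\ 0%N) b & w = (a + b)%N].
  by apply: contrapT => nex; apply: npw.
(* Descend into [a], smaller than [w] as [b] is nonzero; [b] joins the remainder. *)
have [||p pp [s Ss aps]] := IH a _ Sa; first by move: b0 => /=; lia.
  exact: a0.
by exists p => //; exists (s + b)%N; [exact: SD|lia].
Qed.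

Lemma primitive_multiplicity : primitives S m.
Proof.
have [Sm m0 mmin] := multiplicityP.
split; first by split=> //= m0'; lia.
move=> [a [b [[Sa a0] [Sb b0] mab]]].
by have := mmin a Sa; move: a0 b0 => /=; lia.
Qed.

(** In this form truncated subtraction is exact; m itself is excluded because m - m = 0 is in S. *)
Lemma aperyE (w : nat) : (apery S m `\ 0%N) w <->
  [/\ S w, (m < w)%N & gaps S (w - m)%N].
Proof.
have [Sm m0 mmin] := multiplicityP; split.
  move=> [[Sw nw] /= w0]; have mw := mmin w Sw ltac:(lia).
  have Gw : gaps S (w - m)%N by move=> Sd; apply: nw; rewrite subzn //; apply/intset_nat.
  split=> //; rewrite ltn_neqAle mw andbT; apply/eqP => wm.
  by apply: Gw; rewrite -wm subnn.
move=> [Sw mw Gw]; split; last by move=> /=; lia.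
by split=> //; rewrite subzn ?(ltnW mw) // => /intset_nat.
Qed.

Lemma primitive_apery : primitives S `\ m `<=` apery S m `\ 0%N.
Proof.
have [Sm m0 mmin] := multiplicityP.
move=> p [[[Sp /= p0] np] /= pm]; apply/aperyE.
have mp := mmin p Sp ltac:(lia); split=> //; first lia.
(* Otherwise p = m + (p - m) would split the primitive p. *)
by move=> Sd; apply: np; exists m, (p - m)%N; split; [split=> //=; lia..|lia].
Qed.

Lemma finite_apery : finite_set (apery S m `\ 0%N).
Proof.
have [N gN] := finite_set_nat_bound fG.
by apply: (@finite_set_bounded _ (N + m)) => w /aperyE[_ mw /gN]; lia.
Qed.

Lemma finite_primitives : finite_set (primitives S `\ m).
Proof. exact: sub_finite_set primitive_apery finite_apery. Qed.

(** * The three inequalities *)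

Lemma embdim_pred :
  (embdim S)%:Z - 1 = \sum_(p <- fset_set (primitives S `\ m)) 1.
Proof.
have fP : finite_set (primitives S).
  rewrite -(setD1K primitive_multiplicity) finite_setU.
  by split; [exact: finite_set1|exact: finite_primitives].
rewrite fset_setD1 // /embdim (cardfsD1 m) in_fset_set // mem_set /=; last first.
  exact: primitive_multiplicity.
by rewrite PoszD addrC addKr card_fset_sum1 -natz natr_sum.
Qed.

(* For f in PF the element f + m lies in the Apery set, so it has a primitive
   summand p <> m, and f is then counted by nu (p - m). *)
Lemma semigroup_type_le_sum_nu : (semigroup_type S)%:Z
  <= \sum_(p \in primitives S `\ m) (nu S (p%:Z - m%:Z))%:Z.
Proof.
have [Sm m0 mmin] := multiplicityP.
rewrite fsbig_finite; last exact: finite_primitives.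
under eq_bigr do rewrite -natz.
rewrite -natr_sum natz lez_nat.
under eq_bigr do rewrite nu_sum.
rewrite exchange_big /= /semigroup_type card_fset_sum1 big_seq [leqRHS]big_seq.
apply: leq_sum => f; rewrite in_fset_set ?inE; last exact: finite_PF.
move=> pf; have [n fn Gn] := PF_gap pf.
have Snm : S (n + m)%N.
  by apply/intset_nat; rewrite PoszD -fn; apply pf.2; split=> //=; lia.
have [|p pp [s Ss nps]] := primitive_summand Snm; first lia.
have pm : p <> m by move=> pm; apply: Gn; have -> : n = s by lia.
have pin : p \in fset_set (primitives S `\ m).
  by rewrite in_fset_set ?inE //; exact: finite_primitives.
(* The indicator at p equals 1, because f - (p - m) = s. *)
rewrite (big_rem p) //= (asboolT (P := intset S _)) //.
by exists s => //; lia.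
Qed.

Lemma nu_apery_ge1 (w : nat) : (apery S m `\ 0%N) w ->
  0 <= (nu S (w%:Z - m%:Z))%:Z - 1.
Proof.
move=> /aperyE[_ mw /nu_gap_gt0]; rewrite subzn ?(ltnW mw) //; lia.
Qed.

Lemma sum_nu_le_Xi :
  \sum_(p \in primitives S `\ m) (nu S (p%:Z - m%:Z))%:Z
    <= (embdim S)%:Z - 1 + Xi S.
Proof.
have [Sm m0 _] := multiplicityP.
rewrite embdim_pred -lerBlDl fsbig_finite; last exact: finite_primitives.
rewrite -sumrB /Xi fsbig_finite; last exact: finite_apery.
have ap w : w \in fset_set (apery S m `\ 0%N) -> (apery S m `\ 0%N) w.
  by rewrite in_fset_set ?inE //; exact: finite_apery.
(* Intermediate sum: the whole Apéry set, every weight still 1. *)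
apply: (@le_trans _ _ (\sum_(w <- fset_set (apery S m `\ 0%N))
                         ((nu S (w%:Z - m%:Z))%:Z - 1))).
  apply: ler_sum_uniq_sub; try exact: fset_uniq.
    move=> p; rewrite !in_fset_set ?inE; [|exact: finite_apery|exact: finite_primitives].
    exact: primitive_apery.
  by move=> w /ap/nu_apery_ge1.
rewrite big_seq [leRHS]big_seq; apply: ler_sum => w /ap Aw.
rewrite ler_peMl ?nu_apery_ge1 // lez_nat divn_gt0 //.
by have /aperyE[_ /ltnW] := Aw.
Qed.

(* The numbers w - j m, with w in Ap(S, m) \ {0} and 1 <= j <= w / m, are
   pairwise distinct gaps, and nu (w - j m) >= nu (w - m). *)
Lemma Xi_le_Theta : Xi S <= Theta S.
Proof.
have [Sm m0 _] := multiplicityP.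
rewrite /Xi /Theta !fsbig_finite //; last exact: finite_apery.
set A := fset_set (apery S m `\ 0%N).
have ap w : w \in A -> [/\ S w, (m < w)%N & gaps S (w - m)%N].
  by rewrite in_fset_set ?inE; [move/aperyE|exact: finite_apery].
have jw j w : j \in iota 1 (w %/ m) -> [/\ (0 < j)%N & (j * m <= w)%N].
  rewrite mem_iota => /andP[j0 jw]; split=> //.
  by rewrite -leq_divRL //; lia.
have gap_sub w j : w \in A -> j \in iota 1 (w %/ m) -> gaps S (w - j * m)%N.
  move=> /ap[Sw mw Gw] /jw[j0 jmw] Sd; apply: Gw.
  (* Adding back (j - 1) m would put w - m in S. *)
  have -> : (w - m = (w - j * m) + j.-1 * m)%N by case: j j0 jmw Sd => // j; nia.
  by apply: SD => //; exact: semigroup_mulr.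
have uG : uniq [seq (w - j * m)%N | w <- A, j <- iota 1 (w %/ m)].
  apply: allpairs_uniq_dep => [|w _|]; [exact: fset_uniq|exact: iota_uniq|].
  move=> _ _ /allpairsPdep[w [j [wA jI ->]]] /allpairsPdep[w' [j' [wA' jI' ->]]] /=.
  have [j0 jmw] := jw _ _ jI; have [j0' jmw'] := jw _ _ jI'.
  have [Sw mw Gw] := ap _ wA; have [Sw' mw' Gw'] := ap _ wA'.
  (* If j < j', then w' - m = w + (j' - j - 1) m would lie in S, although w' is Apéry; likewise for
     j' < j. *)
  move=> e; have [jj'|jj'|jj'] := ltngtP j j'.
  - case: Gw'; have -> : (w' - m = w + (j' - j).-1 * m)%N by nia.
    by apply: SD => //; exact: semigroup_mulr.
  - case: Gw; have -> : (w - m = w' + (j - j').-1 * m)%N by nia.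
    by apply: SD => //; exact: semigroup_mulr.
  - by subst j'; have -> : w = w' by lia.
have inG x : (x \in fset_set (gaps S)) = `[< gaps S x >].
  by rewrite in_fset_set.
apply: (@le_trans _ _ (\sum_(x <- [seq (w - j * m)%N | w <- A, j <- iota 1 (w %/ m)])
                         ((nu S x%:Z)%:Z - 1))); last first.
  apply: ler_sum_uniq_sub => [//||x|x].
  - exact: fset_uniq.
  - by move=> /allpairsPdep[w [j [wA jI ->]]]; rewrite inG; apply/asboolP/gap_sub.
  - by rewrite inG => /asboolP/nu_gap_gt0; lia.
rewrite big_allpairs_dep /= big_seq [leRHS]big_seq; apply: ler_sum => w wA.
(* The weight w / m becomes a sum of ones indexed by j, to be compared term by term. *)
rewrite -[X in X%:Z * _](size_iota 1) -sum1_size -natz natr_sum mulr_suml.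
rewrite big_seq [leRHS]big_seq; apply: ler_sum => j jI; rewrite mul1r lerD2r lez_nat.
have [j0 jmw] := jw _ _ jI; apply: leq_nu.
have -> : w%:Z - m%:Z - (w - j * m)%N%:Z = (j.-1 * m)%N%:Z by nia.
by apply/intset_nat; exact: semigroup_mulr.
Qed.

End NumericalSemigroup.

Theorem theorem1p2 (S : set nat) (hS : numerical_semigroup S)
    (hSN : S <> [set: nat]) :
  let m := multiplicity S in
  [/\ (semigroup_type S)%:Z
        <= \sum_(p \in primitives S `\ m) (nu S (p%:Z - m%:Z))%:Z,
      \sum_(p \in primitives S `\ m) (nu S (p%:Z - m%:Z))%:Z
        <= (embdim S)%:Z - 1 + Xi S &
      (embdim S)%:Z - 1 + Xi S <= (embdim S)%:Z - 1 + Theta S].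
Proof.
split; [exact: semigroup_type_le_sum_nu|exact: sum_nu_le_Xi|].
by rewrite lerD2l; exact: Xi_le_Theta.
Qed.
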